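(* Let $G\rightrightarrows Q$ be a Lie groupoid, let $L_d:G_2\to\mathbb{R}$ be a discrete second-order Lagrangian, and let $g\in G$. An admissible sequence $\bar g=(g_1,g_2,g_3,g_4)\in C^4_g$ is a solution of the Lagrangian system determined by $L_d$ (i.e. a critical point of the discrete action sum $S_{L_d}$) if and only if $\bar g$ satisfies the discrete second-order Euler-Lagrange equations $$\ell_{g_2}^{*}\big(D_1L_d(g_2,g_3)+D_2L_d(g_1,g_2)\big)+(r_{g_3}\circ i)^{*}\big(D_1L_d(g_3,g_4)+D_2L_d(g_2,g_3)\big)=0 .$$
   Context: A Lie groupoid $G\rightrightarrows Q$ has source $\alpha$ and target $\beta$ (submersions $G\to Q$), identity section $\epsilon:Q\to G$, inversion $i:G\to G$, and multiplication $m(g,h)=gh$ defined on the set of composable pairs $G_2=\{(g,h)\in G\times G\mid \beta(g)=\alpha(h)\}$, with $\alpha(gh)=\alpha(g)$, $\beta(gh)=\beta(h)$. For $g\in G$, the left translation is $\ell_g:\alpha^{-1}(\beta(g))\to\alpha^{-1}(\alpha(g))$, $\ell_g(h)=gh$, and the right translation is $r_g:\beta^{-1}(\alpha(g))\to\beta^{-1}(\beta(g))$, $r_g(h)=hg$. The Lie algebroid $AG\to Q$ has fibre $A_qG=\ker T_{\epsilon(q)}\alpha$ at $q\in Q$. A discrete second-order Lagrangian is a smooth function $L_d:G_2\to\mathbb{R}$. For $g\in G$, the set of admissible sequences is $$C^4_g=\{(g_1,g_2,g_3,g_4)\in G^4\mid (g_k,g_{k+1})\in G_2 \text{ for } k=1,2,3,\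 g_1g_2g_3g_4=g\},$$ where $g_1$ and $g_4$ are fixed elements of $G$ (so only $g_2,g_3$ vary). Variations of $\bar g=(g_1,g_2,g_3,g_4)$ are the curves $c(t)=(g_1,g_2h_2(t),h_2(t)^{-1}g_3,g_4)$ in $C^4_g$ with $h_2(t)\in\alpha^{-1}(\beta(g_2))$ and $h_2(0)=\epsilon(\beta(g_2))$; thus $T_{\bar g}C^4_g$ is identified with $A_{\beta(g_2)}G$ via $v_2=\dot h_2(0)$. The discrete action sum is $S_{L_d}:C^4_g\to\mathbb{R}$, $S_{L_d}(\bar g)=\sum_{k=1}^{3}L_d(g_k,g_{k+1})$. The sequence $\bar g$ is called a solution of the Lagrangian system determined by $L_d$ if it is a critical point of $S_{L_d}$, i.e. $\frac{d}{dt}\big|_{t=0}S_{L_d}(c(t))=0$ for all variations $c$. $D_1L_d(g,h)\in T_g^*G$ and $D_2L_d(g,h)\in T_h^*G$ denote the partial differentials of $L_d$ with respect to its first and second argument (computed with any smooth local extension of $L_d$ to $G\times G$; the left-hand side of the displayed equation does not depend on the extension). The displayed equation is an equality in $A^*_{\beta(g_2)}G$: the pull-backs $\ell_{g_2}^*$ and $(r_{g_3}\circ i)^*$ are taken at the point $\epsilon(\beta(g_2))=\epsilon(\alpha(g_3))$ and evaluated on vectors of $A_{\beta(g_2)}G$, i.e. $\ell_{g_2}^*\mu(v)=\mu(T\ell_{g_2}v)$ and $(r_{g_3}\circ i)^*\mu(v)=\mu(T(r_{g_3}\circ i)v)$. *)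

(* Defs.v *)
From HB Require Import structures.
From mathcomp Require Import all_boot all_order all_algebra.
From mathcomp Require Import all_classical all_reals all_analysis.

Set Implicit Arguments.
Unset Strict Implicit.
Unset Printing Implicit Defensive.

Import Order.TTheory GRing.Theory Num.Theory.
Import numFieldNormedType.Exports.

Local Open Scope classical_set_scope.
Local Open Scope ring_scope.

Section smooth_normed.
Context {R : realType} {V W : normedModType R}.

(* Only used for finite-dimensional V, where x |-> 'd f x is of class C^k as
   soon as x |-> 'd f x v is for each vector v. *)
Fixpoint Ck (k : nat) (U : set V) (f : V -> W) : Prop :=
  match k with
  | 0 => forall x, U x -> {for x, continuous f}
  | k'.+1 => (forall x, U x -> differentiable f x) /\
             (forall v : V, Ck k' U (fun x => 'd f x v))
  end.

Definition Cinfty (U : set V) (f : V -> W) : Prop := forall k, Ck k U f.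

Definition Cinfty_near (x : V) (f : V -> W) : Prop :=
  exists U : set V, [/\ open U, U x & Cinfty U f].

End smooth_normed.

(* [to_model] only matters on [dom], [of_model] only on its image. *)
Record chart (R : realType) (E : normedModType R) (M : topologicalType) :=
  Chart { dom : set M ; to_model : M -> E ; of_model : E -> M }.

Section is_chart.
Context {R : realType} {E : normedModType R} {M : topologicalType}.

Definition cod (c : chart E M) : set E := to_model c @` dom c.

Definition is_chart (c : chart E M) : Prop :=
  [/\ open (dom c), open (cod c),
      forall p, dom c p -> of_model c (to_model c p) = p,
      forall p, dom c p -> {for p, continuous (to_model c)} &
      forall x, cod c x -> {for x, continuous (of_model c)}].

Definition compatible (c d : chart E M) : Prop :=
  Cinfty (to_model c @` (dom c `&` dom d)) (to_model d \o of_model c).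

End is_chart.

(* A space with a chosen chart around each point; the chosen charts form the
   atlas.  Reading tangent vectors at p in the chart chosen at p identifies the
   tangent space at p with the model space E. *)
Record charted (R : realType) (E : normedModType R) := Charted {
  space :> topologicalType ;
  chart_at : space -> chart E space }.

Record manifold (R : realType) (n : nat) := Manifold {
  mfd :> charted 'rV[R]_n ;
  mfd_hausdorff : hausdorff_space mfd ;
  mfd_countable : @second_countable mfd ;
  mfd_chart : forall p : mfd, is_chart (chart_at p) /\ dom (chart_at p) p ;
  mfd_compatible : forall p q : mfd, compatible (chart_at p) (chart_at q) }.

Definition line (R : realType) : charted R^o :=
  {| space := R^o ;
     chart_at := fun=> {| dom := setT ; to_model := id ; of_model := id |} |}.

Definition prod_charted (R : realType) (E F : normedModType R)
    (M : charted E) (N : charted F) : charted (E * F)%type :=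
  {| space := (M * N)%type ;
     chart_at := fun x =>
       {| dom := dom (chart_at x.1) `*` dom (chart_at x.2) ;
          to_model := fun y => (to_model (chart_at x.1) y.1,
                                to_model (chart_at x.2) y.2) ;
          of_model := fun e => (of_model (chart_at x.1) e.1,
                                of_model (chart_at x.2) e.2) |} |}.

Section smooth_maps.
Context {R : realType} {E F : normedModType R}.
Variables (M : charted E) (N : charted F).

Definition in_charts (f : M -> N) (p : M) : E -> F :=
  to_model (chart_at (f p)) \o f \o of_model (chart_at p).

(* Smoothness on some open neighbourhood of p. *)
Definition smooth_at (f : M -> N) (p : M) : Prop :=
  {for p, continuous f} /\
  Cinfty_near (to_model (chart_at p) p) (in_charts f p).

Definition smooth (f : M -> N) : Prop := forall p, smooth_at f p.

Definition tangent (f : M -> N) (p : M) : E -> F :=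
  'd (in_charts f p) (to_model (chart_at p) p).

Definition submersion (f : M -> N) : Prop :=
  smooth f /\ forall p w, exists v, tangent f p v = w.

(* Maps defined on a subset S of M are represented by total functions of which
   only the values on S matter. *)
Definition local_extension (S : set M) (f : M -> N) (p : M) (g : M -> N) :
    Prop :=
  smooth_at g p /\ \forall x \near p, S x -> g x = f x.

(* For an embedded submanifold S this is smoothness for the induced manifold
   structure. *)
Definition smooth_on (S : set M) (f : M -> N) : Prop :=
  forall p, S p -> exists g, local_extension S f p g.

(* The tangent map of f : S -> N, to be applied to vectors tangent to the
   embedded submanifold S, on which the choice of the extension is irrelevant. *)
Definition tangent_on (S : set M) (f : M -> N) (p : M) : E -> F :=
  tangent (xget f (local_extension S f p)) p.

End smooth_maps.

Arguments smooth_at {R E F} M N f p.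
Arguments smooth {R E F} M N f.
Arguments tangent {R E F} M N f p.
Arguments submersion {R E F} M N f.
Arguments local_extension {R E F} M N S f p g.
Arguments smooth_on {R E F} M N S f.
Arguments tangent_on {R E F} M N S f p.

(* As alpha and beta are submersions, the set of composable pairs is an embedded
   submanifold of G * G, so that [smooth_on] applies to the multiplication. *)
Record lie_groupoid (R : realType) (n k : nat)
    (G : manifold R n) (Q : manifold R k) := LieGroupoid {
  alpha : G -> Q ;
  beta : G -> Q ;
  eps : Q -> G ;
  inv : G -> G ;
  mul : G -> G -> G ;
  alpha_submersion : submersion G Q alpha ;
  beta_submersion : submersion G Q beta ;
  eps_smooth : smooth Q G eps ;
  inv_smooth : smooth G G inv ;
  mul_smooth : smooth_on (prod_charted G G) G
    [set x | beta x.1 = alpha x.2] (fun x => mul x.1 x.2) ;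
  alpha_eps : forall q, alpha (eps q) = q ;
  beta_eps : forall q, beta (eps q) = q ;
  alpha_mul : forall g h, beta g = alpha h -> alpha (mul g h) = alpha g ;
  beta_mul : forall g h, beta g = alpha h -> beta (mul g h) = beta h ;
  mulA : forall g h l, beta g = alpha h -> beta h = alpha l ->
    mul (mul g h) l = mul g (mul h l) ;
  mul_eps_l : forall g, mul (eps (alpha g)) g = g ;
  mul_eps_r : forall g, mul g (eps (beta g)) = g ;
  alpha_inv : forall g, alpha (inv g) = beta g ;
  beta_inv : forall g, beta (inv g) = alpha g ;
  mul_inv_r : forall g, mul g (inv g) = eps (alpha g) ;
  mul_inv_l : forall g, mul (inv g) g = eps (beta g) }.

Section discrete_mechanics.
Context {R : realType} {n k : nat} {G : manifold R n} {Q : manifold R k}.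
Variable gr : lie_groupoid G Q.

Definition composable : set (prod_charted G G) :=
  [set x | beta gr x.1 = alpha gr x.2].

Definition alpha_fibre (q : Q) : set G := [set h | alpha gr h = q].

Definition left_translation (g h : G) : G := mul gr g h.

Definition right_translation (g h : G) : G := mul gr h g.

Definition algebroid_fibre (q : Q) : set 'rV[R]_n :=
  [set v | tangent G Q (alpha gr) (eps gr q) v = 0].

(* A second-order Lagrangian on the composable pairs; only its values there
   matter. *)
Definition lagrangian (Ld : G * G -> R) : Prop :=
  smooth_on (prod_charted G G) (line R) composable Ld.

Definition C4 (g : G) : set (G * G * G * G) :=
  [set s | let '(g1, g2, g3, g4) := s in
    [/\ composable (g1, g2), composable (g2, g3), composable (g3, g4) &
        mul gr (mul gr (mul gr g1 g2) g3) g4 = g]].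

Definition action (Ld : G * G -> R) (s : G * G * G * G) : R :=
  let '(g1, g2, g3, g4) := s in
  Ld (g1, g2) + Ld (g2, g3) + Ld (g3, g4).

(* A curve on an open interval around 0, only considered near 0. *)
Definition fibre_curve (q : Q) (h : R -> G) : Prop :=
  [/\ smooth_at (line R) G h 0, \forall t \near (0 : R), alpha gr (h t) = q &
      h 0 = eps gr q].

Definition variation (s : G * G * G * G) (h : R -> G) (t : R) :
    G * G * G * G :=
  let '(g1, g2, g3, g4) := s in
  (g1, mul gr g2 (h t), mul gr (inv gr (h t)) g3, g4).

Definition solution (Ld : G * G -> R) (s : G * G * G * G) : Prop :=
  let '(g1, g2, g3, g4) := s in
  forall h, fibre_curve (beta gr g2) h ->
    is_derive (0 : R) 1 (fun t => action Ld (variation s h t)) 0.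

(* [F x] is a smooth local extension of Ld to G * G around the pair x. *)
Definition local_extensions (Ld : G * G -> R) (F : G * G -> G * G -> R) :
    Prop :=
  forall x, composable x ->
    local_extension (prod_charted G G) (line R) composable Ld x (F x).

Definition D1 (F : G * G -> G * G -> R) (g h : G) : 'rV[R]_n -> R :=
  tangent G (line R) (fun x => F (g, h) (x, h)) g.

Definition D2 (F : G * G -> G * G -> R) (g h : G) : 'rV[R]_n -> R :=
  tangent G (line R) (fun y => F (g, h) (g, y)) h.

(* Pull-back of a covector mu along f, defined on the alpha-fibre through
   eps q, at the point eps q. *)
Definition pullback (q : Q) (f : G -> G) (mu : 'rV[R]_n -> R) :
    'rV[R]_n -> R :=
  mu \o tangent_on G G (alpha_fibre q) f (eps gr q).

Definition second_order_EL (F : G * G -> G * G -> R) (s : G * G * G * G) :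
    Prop :=
  let '(g1, g2, g3, g4) := s in
  forall v, algebroid_fibre (beta gr g2) v ->
    (pullback (beta gr g2) (left_translation g2)
       (D1 F g2 g3 \+ D2 F g1 g2)
     \+ pullback (beta gr g2) (right_translation g3 \o inv gr)
       (D1 F g3 g4 \+ D2 F g2 g3)) v = 0.

End discrete_mechanics.

(* Main.v *)
(* A variation is given by a curve h in the alpha-fibre through
   eps (beta g2).  Near t = 0 the action along it is the sum of the local
   extensions of Ld at (g1, a t), (a t, b t) and (b t, g4), with a t = g2 h(t)
   and b t = h(t)^-1 g3, and the chain rule identifies its derivative at 0 with
   the left-hand side of the equations evaluated at h'(0), a vector of
   ker T alpha.

   Conversely every v in ker T alpha must be shown to be h'(0) for such an h.
   In charts, for f smooth with surjective differential at x0 and v in its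
   kernel, f (x0 + t v + u B) = f x0, where B is a right inverse of the
   differential, is solved for u by the contraction
   u |-> u - (f (x0 + t v + u B) - f x0).  The resulting curve c is Lipschitz,
   hence differentiable with c' = X(c) for a smooth field X, hence smooth by
   induction on the order of differentiability. *)

Require Import Defs.
From HB Require Import structures.
From mathcomp Require Import all_boot all_order all_algebra.
From mathcomp Require Import all_classical all_reals all_analysis ring lra.

Set Implicit Arguments.
Unset Strict Implicit.
Unset Printing Implicit Defensive.

Import Order.TTheory GRing.Theory Num.Theory.
Import numFieldNormedType.Exports.

Local Open Scope classical_set_scope.
Local Open Scope ring_scope.

(** * Differentials and maps of class C^k *)

Section differentials.
Context {R : realType}.
Implicit Types V W : normedModType R.

Lemma differentiable_approx V W (f : V -> W) x (e : R) :
  differentiable f x -> 0 < e ->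
  \forall y \near x, `|f y - f x - 'd f x (y - x)| <= e * `|y - x|.
Proof.
move=> /diff_locally /eqaddoP /(_ e) /[apply] H.
rewrite (near_shift 0 x) subr0; apply: filterS H => y.
by rewrite !fctE /= addrK opprD addrA.
Qed.

(** With [differentiable_approx], replaces the little-o form of the differential by epsilon
    estimates, the form in which Lipschitz bounds on level curves enter. Continuity of [df] is
    assumed because a linear map between arbitrary normed spaces may be discontinuous. *)
Lemma approx_is_diff V W (f : V -> W) (df : {linear V -> W}) x :
  continuous df ->
  (forall e : R, 0 < e ->
    \forall y \near x, `|f y - f x - df (y - x)| <= e * `|y - x|) ->
  is_diff x f df.
Proof.
move=> dfc H.
have E : f \o shift x = cst (f x) + df +o_ 0 id.
  apply/eqaddoP => e /H; rewrite (near_shift 0 x) subr0; apply: filterS => y.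
  by rewrite !fctE /= addrK opprD addrA.
have dE : 'd f x = df :> (V -> W) by exact: diff_unique.
split => //; apply/diff_locallyP; split; first by rewrite dE.
by rewrite dE.
Unshelve. all: by end_near. Qed.

Lemma near_eq_is_diff V W (f g : V -> W) x :
  (\forall y \near x, f y = g y) -> differentiable f x ->
  is_diff x g ('d f x).
Proof.
move=> fg df; apply: approx_is_diff; first exact: diff_continuous.
move=> e e0; have fgx := nbhs_singleton fg; near=> y.
rewrite -fgx -(near fg y) //.
by near: y; exact: differentiable_approx.
Unshelve. all: by end_near. Qed.

Lemma is_diff_linear V W (f : {linear V -> W}) x :
  continuous f -> is_diff x f f.
Proof.
by move=> fc; split; [exact: linear_differentiable | exact: diff_lin].
Qed.

End differentials.

Section scale.
Context {R : realType} {W : normedModType R}.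

(** Reads the scalars as the normed space [R^o], so that the product rule becomes the differential
    of a continuous bilinear map. *)
Let scale (a : R^o) (w : W) : W := a *: w.

Let scale_is_bilinear :
  bilinear_for
    (GRing.Scale.Law.clone _ _ *:%R _) (GRing.Scale.Law.clone _ _ *:%R _)
    scale.
Proof.
split=> [u'|u] a x y; rewrite /scale /=; first by rewrite scalerDl scalerA.
by rewrite scalerDr !scalerA mulrC.
Qed.
HB.instance Definition _ := bilinear_isBilinear.Build R R^o W W _ _
  scale scale_is_bilinear.

Lemma is_diff_scale (V : normedModType R) (a : V -> R^o) (b : V -> W) x :
  differentiable a x -> differentiable b x ->
  is_diff x (fun y => a y *: b y)
    (fun v => a x *: 'd b x v + 'd a x v *: b x).
Proof.
move=> da db.
have Bc : continuous (fun p : R^o * W => scale p.1 p.2).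
  by move=> p; apply: scale_continuous.
have Bd : differentiable (fun p : R^o * W => scale p.1 p.2) (a x, b x).
  exact: differentiable_bilin.
have abd := differentiable_pair da db.
split; first exact: (differentiable_comp abd Bd).
rewrite (diff_comp abd Bd) diff_bilin //= diff_pair //.
Qed.
End scale.

Section Ck_calculus.
Context {R : realType}.
Implicit Types (V W : normedModType R) (k : nat).

(** As [U] is open, agreement on [U] is agreement near each of its points, so the differentials
    agree too and induction on [k] applies. *)
Lemma Ck_eq V W k (U : set V) (f g : V -> W) :
  open U -> (forall x, U x -> f x = g x) -> Ck k U f -> Ck k U g.
Proof.
move=> oU; have nU x : U x -> \forall y \near x, U y.
  by move=> Ux; exact: open_nbhs_nbhs.
elim: k f g => [|k IH] f g fg /=.
  move=> Cf x Ux; rewrite /prop_for /continuous_at -(fg x Ux).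
  apply: cvg_trans (Cf x Ux); apply: near_eq_cvg.
  by apply: filterS (nU _ Ux) => y /fg.
move=> [df Cf].
have dg x : U x -> is_diff x g ('d f x).
  move=> Ux; apply: near_eq_is_diff; last exact: df.
  by apply: filterS (nU _ Ux) => y /fg.
split=> [x /dg|v]; first by case.
by apply: IH (Cf v) => x /dg dgx; rewrite (@diff_val _ _ _ _ _ _ _ dgx).
Qed.

Lemma Ck_subset V W k (U U' : set V) (f : V -> W) :
  U' `<=` U -> Ck k U f -> Ck k U' f.
Proof.
move=> sU; elim: k f => [|k IH] f /= => [Cf x /sU /Cf //|[df Cf]].
by split=> [x /sU /df|v] //; exact: IH.
Qed.

Lemma CkSP V W k (U : set V) (f : V -> W) : Ck k.+1 U f ->
  (forall x, U x -> differentiable f x) /\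
  (forall v, Ck k U (fun x => 'd f x v)).
Proof. by []. Qed.

Lemma Ck_S V W k (U : set V) (f : V -> W) : Ck k.+1 U f -> Ck k U f.
Proof.
elim: k f => [|k IH] f; first by move=> [df _] x /df /differentiable_continuous.
by move=> [df Cf]; split=> // v; exact/IH/Cf.
Qed.

(** Basis of the inductions on [k] below: the differential is supplied as an explicit formula, and
    the class of that formula is checked instead of the class of ['d f]. *)
Lemma CkS_is_diff V W k (U : set V) (f : V -> W) (df : V -> V -> W) :
  open U -> (forall x, U x -> is_diff x f (df x)) ->
  (forall v, Ck k U (df ^~ v)) -> Ck k.+1 U f.
Proof.
move=> oU dfU Cdf; split=> [x /dfU []|v] //.
by apply: Ck_eq (Cdf v) => // x /dfU H; rewrite (@diff_val _ _ _ _ _ _ _ H).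
Qed.

Lemma Ck_cst V W k (U : set V) (a : W) : open U -> Ck k U (cst a : V -> W).
Proof.
move=> oU; elim: k a => [|k IH] a; first by move=> x _; exact: cvg_cst.
apply: (@CkS_is_diff _ _ _ _ _ (fun _ _ => 0)) => // _; exact: IH.
Qed.

Lemma CkD V W k (U : set V) (f g : V -> W) :
  open U -> Ck k U f -> Ck k U g -> Ck k U (fun x => f x + g x).
Proof.
move=> oU; elim: k f g => [|k IH] f g.
  by move=> Cf Cg x Ux; apply: cvgD; [exact: Cf | exact: Cg].
move=> /CkSP[df Cf] /CkSP[dg Cg].
apply: (@CkS_is_diff _ _ _ _ _ (fun x v => 'd f x v + 'd g x v)) => //.
  move=> x Ux.
  by apply: is_diffD; apply: differentiableP; [exact: df | exact: dg].
by move=> v; exact: IH.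
Qed.

Lemma Ck_sum V W k (U : set V) (I : Type) (r : seq I) (P : pred I)
    (f : I -> V -> W) :
  open U -> (forall i, Ck k U (f i)) ->
  Ck k U (fun x => \sum_(i <- r | P i) f i x).
Proof.
move=> oU Cf; elim: r => [|i r IH].
  by under eq_fun do rewrite big_nil; exact: Ck_cst.
under eq_fun do rewrite big_cons; case: (P i) => //.
exact: CkD.
Qed.

Lemma Ck_scale V W k (U : set V) (a : V -> R^o) (f : V -> W) :
  open U -> Ck k U a -> Ck k U f -> Ck k U (fun x => a x *: f x).
Proof.
move=> oU; elim: k a f => [|k IH] a f.
  by move=> Ca Cf x Ux; apply: cvgZ; [exact: Ca | exact: Cf].
move=> Ca Cf; have [[da Cda] [df Cdf]] := (CkSP Ca, CkSP Cf).
apply: (@CkS_is_diff _ _ _ _ _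
  (fun x v => a x *: 'd f x v + 'd a x v *: f x)) => //.
  by move=> x Ux; apply: is_diff_scale; [exact: da | exact: df].
by move=> v; apply: CkD => //; apply: IH => //; exact: Ck_S.
Qed.

Lemma Ck_prod V k (U : set V) (I : Type) (r : seq I) (P : pred I)
    (f : I -> V -> R^o) :
  open U -> (forall i, Ck k U (f i)) ->
  Ck k U ((fun x => \prod_(i <- r | P i) f i x) : V -> R^o).
Proof.
move=> oU Cf; elim: r => [|i r IH].
  by under eq_fun do rewrite big_nil; exact: Ck_cst.
under eq_fun do rewrite big_cons; case: (P i) => //.
exact: Ck_scale.
Qed.

(** The differential of [1/f] is [-(1/f)^2 df], whose factors [1/f] are of class C^k by the
    induction hypothesis. It is written with nested scalings so that [Ck_scale] applies. *)
Lemma CkV V k (U : set V) (f : V -> R^o) :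
  open U -> (forall x, U x -> f x != 0) -> Ck k U f ->
  Ck k U ((fun x => (f x)^-1) : V -> R^o).
Proof.
move=> oU f0; elim: k => [|k IH].
  by move=> Cf x Ux; apply: cvgV; [exact: f0 | exact: Cf].
move=> Cf; have [df Cdf] := CkSP Cf.
apply: (@CkS_is_diff _ _ _ _ _
  (fun x v => ((-1) *: ((f x)^-1 *: (f x)^-1)) *: 'd f x v)) => //.
  move=> x Ux; split; first exact: differentiableV (df _ Ux) (f0 _ Ux).
  rewrite diffV; [| exact: df | exact: f0].
  apply/funext => v /=; congr (_ * _).
  by rewrite /GRing.scale /= mulN1r -invfM -expr2.
move=> v; have CV := IH (Ck_S Cf).
apply: (Ck_scale (a := fun x => -1 *: ((f x)^-1 *: (f x)^-1))) => //.
by apply: (Ck_scale (a := cst (-1))) => //; [exact: Ck_cst | exact: Ck_scale].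
Qed.

Lemma Ck_comp_linear V W (Z : normedModType R) k (U : set V) (f : V -> W)
    (l : {linear W -> Z}) :
  open U -> continuous l -> Ck k U f -> Ck k U (l \o f).
Proof.
move=> oU lc; elim: k f => [|k IH] f.
  by move=> Cf x Ux; apply: continuous_comp; [exact: Cf | exact: lc].
move=> /CkSP[df Cf].
apply: (@CkS_is_diff _ _ _ _ _ (fun x => l \o 'd f x)) => //.
  move=> x Ux; apply: is_diff_comp; first exact/differentiableP/df.
  exact: is_diff_linear.
by move=> v; exact: IH.
Qed.

End Ck_calculus.

Section Ck_coordinates.
Context {R : realType} {V W : normedModType R}.
Implicit Types (k : nat) (U : set V).

Lemma coord_is_linear n (i : 'I_n) :
  linear (fun u : 'rV[R]_n => u 0 i : R^o).
Proof. by move=> a u v; rewrite !mxE. Qed.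

Lemma coord_continuous_rV n (i : 'I_n) :
  continuous (fun u : 'rV[R]_n => u 0 i : R^o).
Proof. exact: coord_continuous. Qed.

Lemma Ck_coord k n U (f : V -> 'rV[R]_n) i :
  open U -> Ck k U f -> Ck k U ((fun x => f x 0 i) : V -> R^o).
Proof.
move=> oU Cf.
pose c : {linear 'rV[R]_n -> R^o} := HB.pack (fun u : 'rV[R]_n => u 0 i : R^o)
    (GRing.isLinear.Build _ _ _ _ _ (coord_is_linear i)).
exact: (Ck_comp_linear (l := c) oU (@coord_continuous_rV _ i) Cf).
Qed.

Lemma Ck_rV k n U (f : V -> 'rV[R]_n) :
  open U -> (forall i, Ck k U ((fun x => f x 0 i) : V -> R^o)) -> Ck k U f.
Proof.
move=> oU Cf.
have -> : f = (fun x => \sum_i f x 0 i *: delta_mx 0 i).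
  by apply/funext => x; exact: row_sum_delta.
apply: Ck_sum => // i; apply: (Ck_scale (a := fun x => f x 0 i)) => //.
exact: Ck_cst.
Qed.

Lemma linear_rVE n (l : {linear 'rV[R]_n -> W}) u :
  l u = \sum_i u 0 i *: l (delta_mx 0 i).
Proof.
rewrite {1}(row_sum_delta u) linear_sum.
by apply: eq_bigr => i _; rewrite linearZ.
Qed.

(** In ['d g (f x) ('d f x v)] the direction varies with [x], while [Ck] controls ['d g] only in
    fixed directions. Expanding ['d f x v] in the standard basis leaves products of its coordinates
    with partial derivatives of [g] along [f], to which the induction hypothesis applies. *)
Lemma Ck_comp k n U (U' : set 'rV[R]_n) (f : V -> 'rV[R]_n)
    (g : 'rV[R]_n -> W) :
  open U -> (forall x, U x -> U' (f x)) ->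
  Ck k U f -> Ck k U' g -> Ck k U (g \o f).
Proof.
move=> oU UU'; elim: k g => [|k IH] g Cf Cg.
  by move=> x Ux; apply: continuous_comp; [exact: Cf | exact/Cg/UU'].
have [[df Cdf] [dg Cdg]] := (CkSP Cf, CkSP Cg).
apply: (@CkS_is_diff _ _ _ _ _ _ (fun x v =>
   \sum_i ('d f x v) 0 i *: ('d g (f x) (delta_mx 0 i)))) => //.
  move=> x Ux; split.
    by apply: differentiable_comp; [exact: df | exact/dg/UU'].
  rewrite diff_comp; [|exact: df | exact/dg/UU'].
  by apply/funext => v /=; exact: linear_rVE.
move=> v; apply: Ck_sum => // i.
apply: (Ck_scale (a := fun x => ('d f x v) 0 i)) => //; first exact: Ck_coord.
apply: (IH (fun y => 'd g y (delta_mx 0 i))); [exact: Ck_S | exact: Cdg].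
Qed.

End Ck_coordinates.

Section matrix_entries.
Context {R : realType} {V : normedModType R}.
Implicit Types (k : nat) (U : set V).

Lemma Ck_mulmx k m n p U (A : V -> 'M[R]_(m, n)) (B : V -> 'M[R]_(n, p)) :
  open U ->
  (forall i j, Ck k U ((fun x => A x i j) : V -> R^o)) ->
  (forall i j, Ck k U ((fun x => B x i j) : V -> R^o)) ->
  forall i j, Ck k U ((fun x => (A x *m B x) i j) : V -> R^o).
Proof.
move=> oU CA CB i j; under eq_fun do rewrite mxE.
by apply: Ck_sum => // l; apply: (Ck_scale (a := fun x => A x i l)).
Qed.

Lemma Ck_det k n U (A : V -> 'M[R]_n) :
  open U -> (forall i j, Ck k U ((fun x => A x i j) : V -> R^o)) ->
  Ck k U ((fun x => \det (A x)) : V -> R^o).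
Proof.
move=> oU CA; rewrite /determinant; apply: Ck_sum => // s.
by apply: (Ck_scale (a := cst _)) => //; [exact: Ck_cst | exact: Ck_prod].
Qed.

(** By Cramer's rule the entries are cofactors divided by the determinant, all polynomial in the
    entries of [A]. *)
Lemma Ck_invmx k n U (A : V -> 'M[R]_n) :
  open U -> (forall x, U x -> A x \in unitmx) ->
  (forall i j, Ck k U ((fun x => A x i j) : V -> R^o)) ->
  forall i j, Ck k U ((fun x => invmx (A x) i j) : V -> R^o).
Proof.
move=> oU uA CA i j.
apply: (@Ck_eq _ _ _ _ _ (fun x => (\det (A x))^-1 * cofactor (A x) j i)) => //.
  by move=> x /uA Ax; rewrite /invmx Ax !mxE.
apply: (Ck_scale (a := fun x => (\det (A x))^-1)) => //.
  by apply: CkV => //; [move=> x /uA; rewrite unitmxE unitfE | exact: Ck_det].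
rewrite /cofactor; apply: (Ck_scale (a := cst _)) => //; first exact: Ck_cst.
by apply: Ck_det => // a b; under eq_fun do rewrite !mxE; exact: CA.
Qed.

Lemma Ck_jacobian k n m (U : set 'rV[R]_n) (f : 'rV[R]_n -> 'rV[R]_m) i j :
  open U -> Ck k.+1 U f -> Ck k U ((fun x => 'J f x i j) : 'rV[R]_n -> R^o).
Proof.
move=> oU /CkSP[_ Cf]; under eq_fun do rewrite mxE.
exact: (Ck_coord _ oU (Cf _)).
Qed.

End matrix_entries.

(** * Norms of row vectors, the mean value inequality and strict differentiability *)

Section row_vectors.
Context {R : realType}.

Lemma coord_le_norm n (u : 'rV[R]_n) i : `|u 0 i| <= `|u|.
Proof.
rewrite [leRHS]/Num.Def.normr /= mx_normrE.
exact: (le_bigmax _ (fun ij => `|u ij.1 ij.2|) (0, i)).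
Qed.

Lemma norm_rV_le n (u : 'rV[R]_n) (e : R) :
  0 <= e -> (forall i, `|u 0 i| <= e) -> `|u| <= e.
Proof.
move=> e0 ue; rewrite [leLHS]/Num.Def.normr /= mx_normrE.
by apply: bigmax_le => // -[i j] _ /=; rewrite ord1.
Qed.

Lemma linear_rV_continuous n (W : normedModType R)
    (l : {linear 'rV[R]_n -> W}) :
  continuous l.
Proof.
have -> : (l : _ -> _) = fun u => \sum_i u 0 i *: l (delta_mx 0 i).
  by apply/funext => u; exact: linear_rVE.
move=> x; apply: (@Ck_sum _ _ _ 0 setT) => // [|i]; first exact: openT.
apply: (Ck_scale (a := fun u : 'rV[R]_n => u 0 i : R^o)); first exact: openT.
  by move=> u _; exact: coord_continuous_rV.
exact/Ck_cst/openT.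
Qed.

Lemma is_diff_coord n (u : 'rV[R]_n) i :
  is_diff u (fun w : 'rV[R]_n => w 0 i : R^o) (fun w => w 0 i).
Proof.
pose c : {linear 'rV[R]_n -> R^o} := HB.pack (fun u : 'rV[R]_n => u 0 i : R^o)
    (GRing.isLinear.Build _ _ _ _ _ (coord_is_linear i)).
exact: (is_diff_linear (f := c) _ (@linear_rV_continuous _ _ c)).
Qed.

Lemma is_diff_is_derive (V W : normedModType R) (f df : V -> W) x v :
  is_diff x f df -> is_derive x v f (df v).
Proof.
by move=> [fx <-]; split; [exact: diff_derivable | rewrite deriveE].
Qed.

Lemma Ck0_near (V W : normedModType R) (U : set V) (f : V -> W) x0 (e : R) :
  U x0 -> Ck 0 U f -> 0 < e -> \forall x \near x0, `|f x - f x0| <= e.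
Proof. by move=> Ux0 /(_ _ Ux0) /cvgr_distC_le; apply. Qed.

Lemma Ck0_neq0 (V : normedModType R) (U : set V) (f : V -> R^o) x0 :
  U x0 -> Ck 0 U f -> f x0 != 0 -> \forall x \near x0, f x != 0.
Proof. by move=> Ux0 /(_ _ Ux0) /cvgr_neq0; apply. Qed.

Lemma nbhs_ball_subset (V : normedModType R) (x : V) (A : set V) :
  nbhs x A -> exists2 r : R, 0 < r & ball x r `<=` A.
Proof. by move=> /nbhs_ballP. Qed.

Lemma segment_ball (V : normedModType R) (x0 x y : V) (r s : R) :
  ball x0 r x -> ball x0 r y -> s \in `[0, 1] ->
  ball x0 r (y + s *: (x - y)).
Proof.
rewrite in_itv /= -!ball_normE /= => bx bY /andP[s0 s1].
have -> : x0 - (y + s *: (x - y)) = s *: (x0 - x) + (1 - s) *: (x0 - y).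
  have -> : x - y = (x0 - y) - (x0 - x).
    by rewrite opprB [RHS]addrC addrA subrK.
  by rewrite opprD addrA scalerBr scalerBl scale1r opprB addrCA.
rewrite (le_lt_trans (ler_normD _ _)) // !normrZ ger0_norm //.
(* Strictness comes from the term of weight [s], which must be positive; for [s = 0] the point is
   [y] itself. *)
rewrite ger0_norm ?subr_ge0 //; case: (ltrP 0 s) => [s_gt0|s_le0].
  rewrite [ltRHS](_ : r = s * r + (1 - s) * r); last by ring.
  apply: ltr_leD; first by rewrite ltr_pM2l.
  by rewrite ler_wpM2l ?subr_ge0 // ltW.
have -> : s = 0 by apply/eqP; rewrite eq_le s_le0.
by rewrite mul0r add0r subr0 mul1r.
Qed.

Lemma MVT01 (h dh : R -> R) :
  (forall s : R, s \in `[0, 1] -> is_derive s 1 h (dh s)) ->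
  exists2 s, s \in `[0, 1] & h 1 - h 0 = dh s.
Proof.
move=> hd.
have hd' (s : R) : s \in `]0, 1[ -> is_derive s 1 h (dh s).
  by move=> /subset_itv_oo_cc; exact: hd.
have hc : {within `[(0 : R), 1], continuous h}.
  by apply: derivable_within_continuous => s /hd; case.
have [s sI] := MVT_segment ler01 hd' hc.
by rewrite subr0 mulr1; exists s.
Qed.

(** The mean value theorem fails for vector values, so it is applied to each coordinate of [f - l]
    along the segment from [y] to [x]. This loses nothing because the norm on row vectors is the
    maximum norm. *)
Lemma mean_value_ball (V : normedModType R) m (f : V -> 'rV[R]_m)
    (l : {linear V -> 'rV[R]_m}) (x0 : V) (r e : R) :
  continuous l -> 0 <= e ->
  (forall x, ball x0 r x -> differentiable f x) ->
  (forall x u, ball x0 r x -> `|'d f x u - l u| <= e * `|u|) ->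
  forall x y, ball x0 r x -> ball x0 r y ->
    `|f x - f y - l (x - y)| <= e * `|x - y|.
Proof.
move=> lc e0 df dle x y bx bY.
apply: norm_rV_le => [|j]; first by rewrite mulr_ge0.
pose p (s : R^o) : V := y + s *: (x - y).
pose h (s : R) : R := (f (p s) - l (p s)) 0 j.
pose dh (s : R) : R := ('d f (p s) (x - y) - l (x - y)) 0 j.
have dp (s : R^o) : is_diff s p (fun t => t *: (x - y)).
  have -> : (fun t : R^o => t *: (x - y)) = 0 + (fun t : R^o => t *: (x - y)).
    by apply/funext => t; rewrite fctE add0r.
  exact: is_diffD (is_diff_cst y s) (is_diff_scalel s (x - y)).
have hd (s : R) : s \in `[0, 1] -> is_derive s 1 h (dh s).
  move=> /(segment_ball bx bY) bp.
  have D1 : is_diff s (f \o p) ('d f (p s) \o (fun t => t *: (x - y))).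
    by apply: is_diff_comp; apply: differentiableP; exact: df.
  have D2 : is_diff s (l \o p) (l \o (fun t => t *: (x - y))).
    by apply: is_diff_comp; exact: is_diff_linear.
  have D3 := is_diff_comp (is_diffB D1 D2) (is_diff_coord _ j).
  have := is_diff_is_derive (1 : R^o) D3.
  by rewrite /= !fctE /= scale1r.
have [s sI] := MVT01 hd.
rewrite /h /p scale1r scale0r addr0 subrKC => E.
have -> : (f x - f y - l (x - y)) 0 j = dh s.
  by rewrite -E linearB !mxE; ring.
apply: le_trans (coord_le_norm _ _) _.
exact: dle (segment_ball bx bY sI).
Qed.

(** Continuous partial derivatives keep ['d f x] uniformly close to ['d f x0] on a small ball, and
    the mean value inequality turns this into an estimate for every pair of points. The contraction
    below needs both points free. *)
Lemma Ck1_strict_differentiable n m (U : set 'rV[R]_n)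
    (f : 'rV[R]_n -> 'rV[R]_m) x0 (e : R) :
  open U -> U x0 -> Ck 1 U f -> 0 < e ->
  exists2 r : R, 0 < r & ball x0 r `<=` U /\
    forall x y, ball x0 r x -> ball x0 r y ->
      `|f x - f y - 'd f x0 (x - y)| <= e * `|x - y|.
Proof.
move=> oU Ux0 /CkSP[df Cdf] e0.
(* The operator bound sums over [n] basis vectors, so each receives a share of [e]; [n.+1] keeps the
   denominator nonzero when [n = 0]. *)
have near_ei : \forall x \near x0, forall i : 'I_n,
    `|'d f x (delta_mx 0 i) - 'd f x0 (delta_mx 0 i)| <= e / n.+1%:R.
  have Fx0 : ProperFilter (nbhs x0) by exact: nbhs_pfilter.
  apply: (@filter_forall _ _ _ (nbhs x0)) => i.
  by apply: Ck0_near Ux0 (Cdf _) _; rewrite divr_gt0.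
have nU : nbhs x0 U by exact: open_nbhs_nbhs.
have [r r0 br] := nbhs_ball_subset (filterI nU near_ei).
exists r => //; split=> [x /br[]//|].
apply: mean_value_ball => //.
- exact: linear_rV_continuous.
- exact: ltW.
- by move=> x /br[/df].
move=> x u /br[Ux ei].
rewrite [X in X - _]linear_rVE [X in _ - X]linear_rVE -sumrB.
apply: le_trans (ler_norm_sum _ _ _) _.
apply: (@le_trans _ _ (\sum_(i < n) `|u| * (e / n.+1%:R))).
  apply: ler_sum => i _; rewrite -scalerBr normrZ.
  by apply: ler_pM => //; exact: coord_le_norm.
rewrite sumr_const card_ord -[leLHS]mulr_natr.
have -> : `|u| * (e / n.+1%:R) * n%:R = (e * `|u|) * (n%:R / n.+1%:R) by ring.
apply: ler_piMr; first by rewrite mulr_ge0 // ltW.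
by rewrite ler_pdivrMr ?mul1r ?ler_nat // ltr0n.
Qed.

End row_vectors.

(** * Smooth curves in level sets *)

(* Matrices are registered as complete and as normed, but not as both. *)
HB.instance Definition _ (R : realType) (m n : nat) :=
  NormedModule.on 'M[R]_(m, n).

Section fixed_points.
Context {R : realType}.

(** Banach's theorem for each [t]: the ball of radius [rho] is stable since its image has norm at
    most [K * T + rho / 2]. Comparing the fixed points at [t] and [s] and absorbing half of their
    distance gives the Lipschitz constant [2 * K]. *)
Lemma parametric_fixed_point (E : completeNormedModType R) (Phi : R -> E -> E)
    (rho T K : R) :
  0 < rho -> 0 < T -> 0 <= K -> K * T <= rho / 2 -> Phi 0 0 = 0 ->
  (forall t s u w, `|t| <= T -> `|s| <= T -> `|u| <= rho -> `|w| <= rho ->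
    `|Phi t u - Phi s w| <= K * `|t - s| + `|u - w| / 2) ->
  exists u : R -> E, [/\ u 0 = 0,
    forall t, `|t| <= T -> `|u t| <= rho /\ Phi t (u t) = u t &
    forall t s, `|t| <= T -> `|s| <= T -> `|u t - u s| <= 2 * K * `|t - s|].
Proof.
move=> rho0 T0 K0 KT Phi00 Phi_lip.
have lip0 t u : `|t| <= T -> `|u| <= rho -> `|Phi t u| <= K * `|t| + `|u| / 2.
  move=> tT ur; have := Phi_lip t 0 u 0 tT _ ur.
  by rewrite Phi00 !subr0 !normr0; apply; exact: ltW.
have ex t : exists u, `|t| <= T -> `|u| <= rho /\ Phi t u = u.
  (* Outside the interval [0] is a dummy value, making the later choice of [u] total. *)
  have [tT|/negP nT] := boolP (`|t| <= T); last by exists 0.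
  pose D : set E := closed_ball_ Num.norm 0 rho.
  have Phi_fun : set_fun D D (Phi t).
    move=> u; rewrite /D /closed_ball_ /= !sub0r !normrN => ur.
    apply: (le_trans (lip0 _ _ tT ur)); rewrite [leRHS]splitr lerD //.
      by apply: le_trans KT; rewrite ler_wpM2l.
    by rewrite ler_wpM2r.
  pose P : {fun D >-> D} :=
    HB.pack (Phi t) (isFun.Build _ _ D D (Phi t) Phi_fun).
  have [|||u] := @banach_fixed_point _ E _ P.
  - have h2 : 0 <= 2^-1 :> R by rewrite invr_ge0.
    exists (NngNum h2); split; first by rewrite /= invf_lt1 ?ltr1n.
    move=> [u w] []; rewrite /D /closed_ball_ /= !sub0r !normrN => ur wr.
    have := Phi_lip t t u w tT tT ur wr.
    by rewrite subrr normr0 mulr0 add0r mulrC.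
  - by rewrite /D; exact: closed_closed_ball_.
  - by exists 0; rewrite /D /closed_ball_ /= subrr normr0 ltW.
  rewrite /D /closed_ball_ /= sub0r normrN => ur uE.
  by exists u => _; split.
have [u uP] := choice ex.
have ulip t s : `|t| <= T -> `|s| <= T -> `|u t - u s| <= 2 * K * `|t - s|.
  move=> tT sT; have [[ut Et] [us Es]] := (uP t tT, uP s sT).
  have := Phi_lip t s (u t) (u s) tT sT ut us.
  by rewrite Et Es; lra.
exists u; split => //.
have T00 : `|0 : R| <= T by rewrite normr0 ltW.
have [u0 E0] := uP 0 T00.
(* At [t = 0] the norm of the fixed point is at most half of itself. *)
have := lip0 0 (u 0) T00 u0; rewrite E0 normr0 mulr0 add0r => H.
by apply/normr0_eq0/eqP; rewrite eq_le normr_ge0 andbT; lra.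
Qed.

End fixed_points.

Lemma diffE_jacobian (R : realType) n k (f : 'rV[R]_n -> 'rV[R]_k) x u :
  'd f x u = u *m 'J f x.
Proof. exact: (esym (mul_rV_lin1 ('d f x) u)). Qed.

Section level_curve.
Context {R : realType} {n k : nat}.
Variables (f : 'rV[R]_n -> 'rV[R]_k) (U : set 'rV[R]_n) (x0 : 'rV[R]_n).
Variables (B : 'M[R]_(k, n)) (v : 'rV[R]_n).
Hypotheses (oU : open U) (Ux0 : U x0) (df1 : Ck 1 U f).
Hypotheses (dfB : forall u, 'd f x0 (u *m B) = u) (dfv : 'd f x0 v = 0).

(** With [b] a Lipschitz constant of multiplication by [B] and strict differentiability at precision
    [(2 * b)^-1], the map [Phi] contracts by [1/2] in [u] and is Lipschitz with constant
    [|v| / (2 b)] in [t]. *)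
Lemma level_curve_lipschitz :
  exists (u : R -> 'rV[R]_k) (T C : R), [/\ 0 < T, 0 < C, u 0 = 0,
    forall t, `|t| <= T -> U (x0 + t *: v + u t *m B) /\
                        f (x0 + t *: v + u t *m B) = f x0 &
    forall t s, `|t| <= T -> `|s| <= T -> `|u t - u s| <= C * `|t - s|].
Proof.
have [b b0 Bb] := linear_lipschitz (@linear_rV_continuous _ _ _ (mulmxr B)).
have e0 : 0 < (2 * b)^-1 by rewrite invr_gt0 mulr_gt0.
have [r r0 [rU fr]] := Ck1_strict_differentiable oU Ux0 df1 e0.
pose p (t : R) u := x0 + t *: v + u *m B.
pose Phi t u := u - (f (p t u) - f x0).
(* [T] and [rho] bound [t *: v] and [u *m B] by [r / 4] each, so [p t u] stays in the ball of radius
   [r]; adding 1 to the norm of [v] covers [v = 0]. *)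
pose T := r / (4 * (`|v| + 1)).
pose rho := r / (4 * b).
have v1 : 0 < `|v| + 1 by rewrite ltr_wpDl.
have T0 : 0 < T by rewrite divr_gt0 // mulr_gt0.
have rho0 : 0 < rho by rewrite divr_gt0 // mulr_gt0.
have p_ball t u : `|t| <= T -> `|u| <= rho -> ball x0 r (p t u).
  move=> tT ur; rewrite -ball_normE /= /p -addrA opprD addrA subrr sub0r normrN.
  apply: (le_lt_trans (ler_normD _ _)); rewrite normrZ.
  have Tv : `|t| * `|v| <= r / 4.
    apply: (@le_trans _ _ (T * (`|v| + 1))).
      by apply: ler_pM => //; rewrite lerDl.
    by rewrite /T invfM mulrA divfK // gt_eqF.
  have Ub : `|u *m B| <= r / 4.
    apply: le_trans (Bb u) _; rewrite mulrC.
    have -> : r / 4 = rho * b by rewrite /rho invfM mulrA divfK // gt_eqF.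
    by rewrite ler_wpM2r // ltW.
  by apply: le_lt_trans (lerD Tv Ub) _; lra.
have dp t s u w : p t u - p s w = (t - s) *: v + (u - w) *m B.
  by rewrite /p mulmxBl; apply/rowP => i; rewrite !mxE; ring.
have := @parametric_fixed_point R _ Phi rho T ((2 * b)^-1 * `|v|) rho0 T0.
case=> [|||t s u w tT sT ur wr|u [u0 uP ulip]].
- by rewrite mulr_ge0 // ltW.
- have -> : (2 * b)^-1 * `|v| * T = rho / 2 * (`|v| / (`|v| + 1)).
    by rewrite /T /rho; field; rewrite !gt_eqF.
  apply: ler_piMr; first by rewrite divr_ge0 // ltW.
  by rewrite ler_pdivrMr // mul1r lerDl.
- by rewrite /Phi /p scale0r mul0mx !addr0 !subrr.
(* Since ['d f x0] kills [v] and inverts [B], the difference is exactly minus the remainder in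
   strict differentiability. *)
- have -> : Phi t u - Phi s w =
      - (f (p t u) - f (p s w) - 'd f x0 (p t u - p s w)).
    have -> : 'd f x0 (p t u - p s w) = u - w.
      by rewrite dp linearD linearZ /= dfv scaler0 add0r; exact: dfB.
    by rewrite /Phi; apply/rowP => i; rewrite !mxE; ring.
  rewrite normrN.
  apply: le_trans (fr _ _ (p_ball _ _ tT ur) (p_ball _ _ sT wr)) _; rewrite dp.
  apply: (@le_trans _ _ ((2 * b)^-1 * (`|t - s| * `|v| + b * `|u - w|))).
    rewrite ler_wpM2l ?(ltW e0) //; apply: le_trans (ler_normD _ _) _.
    by rewrite normrZ lerD //; exact: Bb.
  by rewrite le_eqVlt; apply/orP; left; apply/eqP; field; rewrite gt_eqF.
(* The added 1 makes the constant positive even for [v = 0]. *)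
- exists u, T, (2 * ((2 * b)^-1 * `|v|) + 1); split=> //.
  + by rewrite ltr_wpDl // !mulr_ge0 // ltW.
  + move=> t tT; have [ur] := uP t tT; rewrite /Phi => /eqP.
    rewrite subr_eq addrC -subr_eq subrr eq_sym subr_eq0 => /eqP E.
    by split => //; apply: rU; exact: p_ball.
  + move=> t s tT sT; apply: le_trans (ulip t s tT sT) _.
    by rewrite ler_wpM2r // lerDl.
Qed.

Hypothesis (unitBJ : forall x, U x -> B *m 'J f x \in unitmx).

(* Differentiating f (c t) = f x0 along c t = x0 + t v + u(t) B and solving for
   u' gives c' = level_field c. *)
Definition level_field (x : 'rV[R]_n) : 'rV[R]_n :=
  v - v *m ('J f x *m invmx (B *m 'J f x) *m B).

Lemma Ck_level_field j : Ck j.+1 U f -> Ck j U level_field.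
Proof.
move=> Cf; have CJ i l := Ck_jacobian i l oU Cf.
have CB a b : Ck j U ((fun=> B a b) : 'rV[R]_n -> R^o) by exact: Ck_cst.
have CN a b : Ck j U ((fun x => invmx (B *m 'J f x) a b) : 'rV[R]_n -> R^o).
  apply: (Ck_invmx (A := fun x => B *m 'J f x)) => // c d.
  exact: (Ck_mulmx (A := fun=> B) (B := fun x => 'J f x)).
have CJN := Ck_mulmx oU CJ CN.
have CJNB := Ck_mulmx (B := fun=> B) oU CJN CB.
have Cv a b : Ck j U ((fun=> (- v) a b) : 'rV[R]_n -> R^o) by exact: Ck_cst.
apply: Ck_rV => // i.
rewrite (_ : (fun x => _) = fun x => v 0 i +
    (- v *m ('J f x *m invmx (B *m 'J f x) *m B)) 0 i); last first.
  by apply/funext => x; rewrite /level_field mulNmx !mxE.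
apply: CkD => //; first exact: Ck_cst.
exact: (Ck_mulmx (A := fun=> - v) oU Cv CJNB).
Qed.

Variables (u : R -> 'rV[R]_k) (T C : R).
Hypotheses (C0 : 0 < C).
Let c (t : R^o) : 'rV[R]_n := x0 + t *: v + u t *m B.
Hypothesis uP : forall t, `|t| <= T -> U (c t) /\ f (c t) = f x0.
Hypothesis ulip : forall t s, `|t| <= T -> `|s| <= T ->
  `|u t - u s| <= C * `|t - s|.

Lemma level_curve_subE t s : c s - c t = (s - t) *: v + (u s - u t) *m B.
Proof. by rewrite /c mulmxBl; apply/rowP => i; rewrite !mxE; ring. Qed.

(** As [f] is constant along [c], the increment of [c] times the Jacobian is small compared with
    that increment, hence with [s - t] by the Lipschitz bound. Multiplying by [N] turns it into the
    error of the linear approximation of [c]. *)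
Lemma level_curve_is_diff (t : R^o) :
  `|t| < T -> is_diff t c (fun s => s *: level_field (c t)).
Proof.
move=> tT; set w := level_field (c t).
have [Uct fct] := uP (ltW tT).
pose N := invmx (B *m 'J f (c t)) *m B.
have [b b0 Bb] := linear_lipschitz (@linear_rV_continuous _ _ _ (mulmxr B)).
have [g g0 Ng] := linear_lipschitz (@linear_rV_continuous _ _ _ (mulmxr N)).
pose K := `|v| + b * C.
have K0 : 0 < K by rewrite ltr_wpDl // mulr_gt0.
have clip s : `|s| <= T -> `|c s - c t| <= K * `|s - t|.
  move=> sT; rewrite level_curve_subE /K mulrDl.
  apply: le_trans (ler_normD _ _) _; rewrite normrZ mulrC lerD //.
  apply: le_trans (Bb _) _; rewrite -mulrA ler_wpM2l ?(ltW b0) //.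
  exact: ulip (ltW tT).
have L := is_diff_scalel t w.
rewrite -(@diff_val _ _ _ _ _ _ _ L); apply: approx_is_diff.
  by apply: diff_continuous; case: L.
move=> e e0; rewrite (@diff_val _ _ _ _ _ _ _ L).
have df : differentiable f (c t) by have [+ _] := CkSP df1; apply.
(* [g] and [K] are the factors lost in multiplying by [N] and in passing from [c s - c t] to
   [s - t]. *)
have e'0 : 0 < e / (g * K) by rewrite divr_gt0 // mulr_gt0.
have [r r0 rf] := nbhs_ball_subset (differentiable_approx df e'0).
have near_t : \forall s \near t, `|s| <= T /\ `|s - t| < r / K.
  have d0 : 0 < Num.min (T - `|t|) (r / K).
    by rewrite lt_min subr_gt0 tT divr_gt0.
  apply: filterS (nbhsx_ballx t _ d0) => s.
  rewrite -ball_normE /= lt_min distrC => /andP[sT sr]; split=> //.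
  by rewrite -(subrK t s) (le_trans (ler_normD _ _)) // -lerBrDr ltW.
apply: filterS near_t => s [sT st].
have cr : ball (c t) r (c s).
  rewrite -ball_normE /= distrC; apply: le_lt_trans (clip s sT) _.
  by rewrite mulrC -ltr_pdivlMr.
have [_ fcs] := uP sT.
have := rf _ cr; rewrite fcs fct subrr sub0r normrN diffE_jacobian => Hf.
(* The unknown increment of [u] drops out because [B *m 'J f (c t) *m N = B]. *)
have -> : c s - c t - (s - t) *: w = (c s - c t) *m 'J f (c t) *m N.
  rewrite level_curve_subE /w /level_field; move: (u s - u t) => d.
  rewrite mulmxDl -(mulmxA d) mulmxDl /N (mulmxA (d *m _)) -(mulmxA d).
  rewrite mulmxV ?unitBJ // mulmx1 scalerBr -!scalemxAl !mulmxA.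
  by apply/rowP => i; rewrite !mxE; ring.
apply: le_trans (Ng _) _.
apply: (@le_trans _ _ (g * (e / (g * K) * (K * `|s - t|)))).
  rewrite ler_wpM2l ?(ltW g0) //; apply: le_trans Hf _.
  by rewrite ler_wpM2l ?(ltW e'0) //; exact: clip.
rewrite le_eqVlt; apply/orP; left; apply/eqP; field.
by rewrite !gt_eqF.
Qed.

Lemma level_curve_Cinfty (I := [set t : R^o | `|t| < T]) :
  open I -> Cinfty U f -> Cinfty I c.
Proof.
move=> oI Cf; elim=> [|j IH].
  move=> t It; apply: differentiable_continuous.
  by case: (level_curve_is_diff It).
apply: (@CkS_is_diff _ R^o _ _ _ _
  (fun t s => s *: level_field (c t))) => // [t It|s].
  exact: level_curve_is_diff.
apply: (Ck_scale (a := fun=> s)) => //; first exact: Ck_cst.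
apply: (Ck_comp (U' := U)) => //; last exact/Ck_level_field/Cf.
by move=> t /ltW /uP[].
Qed.

End level_curve.

Section level_set.
Context {R : realType} {n k : nat}.

(** The rows of [B] are chosen preimages of the standard basis vectors. *)
Lemma surjective_right_inverse (l : {linear 'rV[R]_n -> 'rV[R]_k}) :
  (forall w, exists v, l v = w) ->
  exists B : 'M[R]_(k, n), forall u, l (u *m B) = u.
Proof.
move=> sl; have [b bP] := choice (fun i : 'I_k => sl (delta_mx 0 i)).
exists (\matrix_i b i) => u; rewrite mulmx_sum_row linear_sum.
rewrite [RHS]row_sum_delta; apply: eq_bigr => i _.
by rewrite linearZ rowK bP.
Qed.

Theorem curve_in_level_set (U : set 'rV[R]_n) (f : 'rV[R]_n -> 'rV[R]_k) x0 v :
  open U -> U x0 -> Cinfty U f -> (forall w, exists u, 'd f x0 u = w) ->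
  'd f x0 v = 0 ->
  exists c : R^o -> 'rV[R]_n, [/\ Cinfty_near (0 : R^o) c, c 0 = x0,
    is_diff (0 : R^o) c (fun s => s *: v) &
    \forall t \near (0 : R^o), f (c t) = f x0].
Proof.
move=> oU Ux0 Cf sf dfv.
have [B dfB] := surjective_right_inverse sf.
have BJ1 : B *m 'J f x0 = 1%:M.
  apply/row_matrixP => i; rewrite row1 row_mul -diffE_jacobian rowE.
  exact: dfB.
(* The determinant is 1 at [x0]; shrinking [U] to a ball where it does not vanish makes
   [level_field] smooth there. *)
have det_near : \forall x \near x0, \det (B *m 'J f x) != 0.
  have Cdet : Ck 0 U ((fun x => \det (B *m 'J f x)) : 'rV[R]_n -> R^o).
    apply: Ck_det => //; apply: (Ck_mulmx (A := fun=> B)) => // i j.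
      exact: Ck_cst.
    exact/Ck_jacobian/Cf.
  by apply: Ck0_neq0 Ux0 Cdet _; rewrite BJ1 det1 oner_neq0.
have nU : nbhs x0 U by exact: open_nbhs_nbhs.
have [r r0 br] := nbhs_ball_subset (filterI nU det_near).
pose U' := ball x0 r.
have oU' : open U' by exact: ball_open.
have U'x0 : U' x0 by exact: ballxx.
have Cf' : Cinfty U' f by move=> j; apply: Ck_subset (Cf j) => x /br[].
have unitBJ x : U' x -> B *m 'J f x \in unitmx.
  by move=> /br[_]; rewrite unitmxE unitfE.
have [u [T [C [T0 C0 u0 uP ulip]]]] :=
  level_curve_lipschitz oU' U'x0 (Cf' 1) dfB dfv.
pose c (t : R^o) : 'rV[R]_n := x0 + t *: v + u t *m B.
have c0 : c 0 = x0 by rewrite /c u0 scale0r mul0mx !addr0.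
have oI : open [set t : R^o | `|t| < T].
  rewrite (_ : [set _ | _] = ball (0 : R^o) T); first exact: ball_open.
  by apply/seteqP; split=> t; rewrite -ball_normE /= sub0r normrN.
exists c; split => //.
- exists [set t : R^o | `|t| < T]; split=> //=; first by rewrite normr0.
  exact: (level_curve_Cinfty oU' (Cf' 1) unitBJ C0 uP ulip oI Cf').
- have T00 : `|0 : R^o| < T by rewrite normr0.
  have := level_curve_is_diff (Cf' 1) unitBJ C0 uP ulip T00.
  (* The correction term of the field vanishes at [x0] because [v] lies in the kernel of the
     differential. *)
  rewrite -/(c 0) c0 (_ : level_field f B v x0 = v) //.
  by rewrite /level_field !mulmxA -diffE_jacobian dfv !mul0mx subr0.
- have : nbhs (0 : R^o) [set t : R^o | `|t| < T].
    by apply: open_nbhs_nbhs; split=> //=; rewrite normr0.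
  by apply: filterS => t /ltW /uP[].
Qed.

End level_set.

(** * Partial maps of functions on a product *)

Section Ck_slices.
Context {R : realType} {V1 V2 W : normedModType R}.
Implicit Types (U : set (V1 * V2)) (F : V1 * V2 -> W).

Lemma open_slice1 U y : open U -> open [set x | U (x, y)].
Proof.
move=> oU; rewrite openE => x /= Uxy.
have c : {for x, continuous (fun x' : V1 => (x', y))}.
  by apply: cvg_pair => //; exact: cvg_cst.
exact: (c _ (open_nbhs_nbhs (conj oU Uxy))).
Qed.

Lemma open_slice2 U x : open U -> open [set y | U (x, y)].
Proof.
move=> oU; rewrite openE => y /= Uxy.
have c : {for y, continuous (fun y' : V2 => (x, y'))}.
  by apply: cvg_pair => //; exact: cvg_cst.
exact: (c _ (open_nbhs_nbhs (conj oU Uxy))).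
Qed.

Lemma is_diff_slice1 F (x : V1) y : differentiable F (x, y) ->
  is_diff x (fun x' => F (x', y)) (fun v => 'd F (x, y) (v, 0)).
Proof.
move=> dF; have D := is_diff_pair (is_diff_id x) (is_diff_cst y x).
exact: (is_diff_comp D (differentiableP dF)).
Qed.

Lemma is_diff_slice2 F x (y : V2) : differentiable F (x, y) ->
  is_diff y (fun y' => F (x, y')) (fun v => 'd F (x, y) (0, v)).
Proof.
move=> dF; have D := is_diff_pair (is_diff_cst x y) (is_diff_id y).
exact: (is_diff_comp D (differentiableP dF)).
Qed.

Lemma Ck_slice1 k U F y : open U -> Ck k U F ->
  Ck k [set x | U (x, y)] (fun x => F (x, y)).
Proof.
move=> oU; have oU1 := open_slice1 y oU.
elim: k F => [|k IH] F.
  move=> CF x /= Uxy; apply: (continuous_comp _ (CF _ Uxy)).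
  by apply: cvg_pair => //; exact: cvg_cst.
move=> /CkSP[dF CF].
apply: (@CkS_is_diff _ _ _ _ _ _
  (fun x v => 'd F (x, y) (v, 0))) => // [x /= Uxy|v].
  exact/is_diff_slice1/dF.
exact: (IH (fun p => 'd F p (v, 0)) (CF _)).
Qed.

Lemma Ck_slice2 k U F x : open U -> Ck k U F ->
  Ck k [set y | U (x, y)] (fun y => F (x, y)).
Proof.
move=> oU; have oU1 := open_slice2 x oU.
elim: k F => [|k IH] F.
  move=> CF y /= Uxy; apply: (continuous_comp _ (CF _ Uxy)).
  by apply: cvg_pair => //; exact: cvg_cst.
move=> /CkSP[dF CF].
apply: (@CkS_is_diff _ _ _ _ _ _
  (fun y v => 'd F (x, y) (0, v))) => // [y /= Uxy|v].
  exact/is_diff_slice2/dF.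
exact: (IH (fun p => 'd F p (0, v)) (CF _)).
Qed.

End Ck_slices.

(** * Calculus in charts *)

Section atlas.
Context {R : realType} {E : normedModType R}.

(** Stated for any charted space, so that the same lemmas serve manifolds, the line and products. *)
Definition atlas (M : charted E) : Prop :=
  forall p : M, is_chart (chart_at p) /\ dom (chart_at p) p.

Context {M : charted E}.
Hypothesis aM : atlas M.
Implicit Types p : M.

Lemma of_model_at p : of_model (chart_at p) (to_model (chart_at p) p) = p.
Proof. by have [[_ _ K _ _] dp] := aM p; exact: K. Qed.

Lemma near_dom p : \forall y \near p, dom (chart_at p) y.
Proof. by have [[oD _ _ _ _] dp] := aM p; exact: open_nbhs_nbhs. Qed.

Lemma cod_at p : cod (chart_at p) (to_model (chart_at p) p).
Proof. by have [_ dp] := aM p; exists p. Qed.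

Lemma near_cod p : \forall x \near to_model (chart_at p) p, cod (chart_at p) x.
Proof.
have [[_ oC _ _ _] _] := aM p.
by apply: open_nbhs_nbhs; split=> //; exact: cod_at.
Qed.

Lemma of_modelK p x : cod (chart_at p) x ->
  to_model (chart_at p) (of_model (chart_at p) x) = x /\
  dom (chart_at p) (of_model (chart_at p) x).
Proof. by have [[_ _ K _ _] _] := aM p; case=> y dy <-; rewrite K. Qed.

Lemma of_model_cvg p :
  of_model (chart_at p) x @[x --> to_model (chart_at p) p] --> p.
Proof.
have [[_ _ _ _ C] _] := aM p; have := C _ (cod_at p).
by rewrite /prop_for /continuous_at of_model_at.
Qed.

Lemma near_of_model p (P : set M) : (\forall y \near p, P y) ->
  \forall x \near to_model (chart_at p) p, P (of_model (chart_at p) x).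
Proof. by move=> nP; exact: (of_model_cvg nP). Qed.

Lemma of_model_comp_cvg p (T : topologicalType) (c : T -> E) (t : T) :
  c x @[x --> t] --> to_model (chart_at p) p ->
  of_model (chart_at p) (c x) @[x --> t] --> p.
Proof. by move=> cc A nA; exact: cc _ (of_model_cvg nA). Qed.

End atlas.

Lemma atlas_line (R : realType) : atlas (line R).
Proof.
move=> p; split=> //; split=> //=; first exact: openT.
- rewrite /cod /= image_id; exact: openT.
- by move=> x _; exact: cvg_id.
- by move=> x _; exact: cvg_id.
Qed.

Lemma atlas_manifold (R : realType) n (M : manifold R n) : atlas M.
Proof. exact: mfd_chart. Qed.

Lemma continuous_prod_map (T1 T2 S1 S2 : topologicalType) (f : T1 -> S1)
    (g : T2 -> S2) (z : T1 * T2) :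
  {for z.1, continuous f} -> {for z.2, continuous g} ->
  {for z, continuous (fun w : T1 * T2 => (f w.1, g w.2))}.
Proof.
case: z => x y /= cf cg; pose z := (x, y).
have c1 : w.1 @[w --> z] --> x by exact: cvg_fst.
have c2 : w.2 @[w --> z] --> y by exact: cvg_snd.
have cf' : f w.1 @[w --> z] --> f x by exact: cvg_comp c1 cf.
have cg' : g w.2 @[w --> z] --> g y by exact: cvg_comp c2 cg.
exact: cvg_pair cf' cg'.
Qed.

Lemma open_setX (T1 T2 : topologicalType) (A : set T1) (B : set T2) :
  open A -> open B -> open (A `*` B).
Proof.
move=> oA oB; rewrite openE => -[x y] [Ax By]; exists (A, B) => //=.
by split; exact: open_nbhs_nbhs.
Qed.

Lemma atlas_prod (R : realType) (E F : normedModType R) (M : charted E)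
    (N : charted F) : atlas M -> atlas N -> atlas (prod_charted M N).
Proof.
move=> aM aN [p q] /=.
have [[oM cM KM tM uM] dp] := aM p; have [[oN cN KN tN uN] dq] := aN q.
have codE : cod (chart_at ((p, q) : prod_charted M N)) =
    cod (chart_at p) `*` cod (chart_at q).
  apply/seteqP; split=> [_ [[x y] /= [dx dy] <-]|].
    by split; [exists x | exists y].
  by move=> [_ _] /= [[x dx <-] [y dy <-]]; exists (x, y).
split; last by split.
split; rewrite ?codE //=.
- exact: open_setX.
- exact: open_setX.
- by move=> [x y] [dx dy] /=; rewrite KM // KN.
- by move=> z [dx dy]; apply: continuous_prod_map; [exact: tM | exact: tN].
- by move=> z [dx dy]; apply: continuous_prod_map; [exact: uM | exact: uN].
Qed.

Lemma cvg_near_pair (T S1 S2 : topologicalType) (f : T -> S1) (g : T -> S2)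
    (t : T) (x : S1) (y : S2) (P : S1 * S2 -> Prop) :
  f s @[s --> t] --> x -> g s @[s --> t] --> y ->
  (\forall z \near (x, y), P z) -> \forall s \near t, P (f s, g s).
Proof. by move=> fx gy; exact: (cvg_pair fx gy). Qed.

Section maps.
Context {R : realType}.

Lemma Ck_open_preimage (V W : normedModType R) k (f : V -> W) (A : set V)
    (B : set W) :
  open A -> open B -> Ck k A f -> open (A `&` f @^-1` B).
Proof.
move=> oA oB; elim: k => [cf|k IH /Ck_S/IH //].
rewrite openE => x [Ax Bfx]; apply: filterI; first exact: open_nbhs_nbhs.
exact: (cf x Ax _ (open_nbhs_nbhs (conj oB Bfx))).
Qed.

Lemma nbhs_open_subset (T : topologicalType) (x : T) (A : set T) :
  nbhs x A -> exists U, [/\ open U, U x & U `<=` A].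
Proof.
move=> nA; exists A^°; split; [exact: open_interior | exact: nA |].
exact: interior_subset.
Qed.

(** Enough for first-order chain rules with arbitrary model spaces, in particular through the
    product [G * G], whereas [smooth_at_comp] has a middle space modelled on row vectors. *)
Definition differentiable_at (E F : normedModType R) (M : charted E)
    (N : charted F) (f : M -> N) (p : M) : Prop :=
  {for p, continuous f} /\
  differentiable (in_charts f p) (to_model (chart_at p) p).

Lemma smooth_differentiable_at (E F : normedModType R) (M : charted E)
    (N : charted F) (f : M -> N) p : smooth_at M N f p -> differentiable_at f p.
Proof.
by move=> [cf [U [_ Up Cf]]]; split=> //; have [df _] := CkSP (Cf 1); exact: df.
Qed.

Section near_eq.
Context {E F : normedModType R} {M : charted E} {N : charted F}.
Hypothesis aM : atlas M.
Variables (f g : M -> N) (p : M).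
Hypothesis fg : \forall x \near p, f x = g x.

Lemma in_charts_near_eq :
  \forall x \near to_model (chart_at p) p, in_charts f p x = in_charts g p x.
Proof.
apply: filterS (near_of_model aM fg) => x.
by rewrite /in_charts /= (nbhs_singleton fg) => ->.
Qed.

Lemma continuous_near_eq : {for p, continuous f} -> {for p, continuous g}.
Proof.
rewrite /prop_for /continuous_at (nbhs_singleton fg) => cf.
by apply: cvg_trans cf; exact: near_eq_cvg.
Qed.

Lemma near_eq_differentiable_at : differentiable_at f p ->
  differentiable_at g p /\ tangent M N g p = tangent M N f p :> (E -> F).
Proof.
move=> [cf df]; have D := near_eq_is_diff in_charts_near_eq df.
split; last by rewrite /tangent (@diff_val _ _ _ _ _ _ _ D).
by split; [exact: continuous_near_eq | case: D].
Qed.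

End near_eq.

Section composition.
Context {E F D : normedModType R}.
Context {M : charted E} {N : charted F} {P : charted D}.
Hypotheses (aM : atlas M) (aN : atlas N).
Variables (f : M -> N) (g : N -> P) (p : M).

Lemma in_charts_at : in_charts f p (to_model (chart_at p) p) =
  to_model (chart_at (f p)) (f p).
Proof. by rewrite /in_charts /= of_model_at. Qed.

(** The chart at [f p] cancels wherever [f] takes values in its domain, which continuity ensures
    near [p]. *)
Lemma in_charts_comp_near : {for p, continuous f} ->
  \forall x \near to_model (chart_at p) p,
    in_charts g (f p) (in_charts f p x) = in_charts (g \o f) p x.
Proof.
move=> cf; have nf := near_of_model aM (cf _ (near_dom aN (f p))).
apply: filterS nf => x /= dx; rewrite /in_charts /=.
by have [[_ _ K _ _] _] := aN (f p); rewrite K.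
Qed.

Lemma tangent_comp : differentiable_at f p -> differentiable_at g (f p) ->
  differentiable_at (g \o f) p /\
  tangent M P (g \o f) p = tangent N P g (f p) \o tangent M N f p :> (E -> D).
Proof.
move=> [cf df] [cg dg].
have dg' : differentiable (in_charts g (f p))
    (in_charts f p (to_model (chart_at p) p)) by rewrite in_charts_at.
have dgf := differentiable_comp df dg'.
have D' := near_eq_is_diff (in_charts_comp_near cf) dgf.
split; first by split; [exact: continuous_comp | case: D'].
by rewrite /tangent (@diff_val _ _ _ _ _ _ _ D') diff_comp // in_charts_at.
Qed.

End composition.

Lemma smooth_at_comp n (E D : normedModType R) (M : charted E)
    (N : charted 'rV[R]_n) (P : charted D) (f : M -> N) (g : N -> P) p :
  atlas M -> atlas N ->
  smooth_at M N f p -> smooth_at N P g (f p) -> smooth_at M P (g \o f) p.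
Proof.
move=> aM aN [cf [U [oU Up Cf]]] [cg [V [oV Vfp Cg]]].
split; first exact: continuous_comp.
have [A [oA Ap AE]] := nbhs_open_subset (in_charts_comp_near aM aN g cf).
(* On [A] the chart expressions compose; on [U'] the inner one is smooth and lands where the outer
   one is. *)
pose U' := U `&` in_charts f p @^-1` V.
have oU' : open U' by exact: Ck_open_preimage oU oV (Cf 0).
exists (A `&` U'); split; first exact: openI.
  by split=> //; split=> //=; rewrite in_charts_at.
move=> k; apply: (@Ck_eq _ _ _ _ _ (in_charts g (f p) \o in_charts f p)).
- exact: openI.
- by move=> x [/AE].
- apply: (Ck_comp (U' := V)); first exact: openI.
  + by move=> x [_ []].
  + by apply: Ck_subset (Cf k) => x [_ []].
  + exact: Cg.
Qed.

Lemma smooth_at_slice1 (E F D : normedModType R) (M : charted E)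
    (N : charted F) (P : charted D) (f : M * N -> P) x y :
  atlas M -> atlas N -> smooth_at (prod_charted M N) P f (x, y) ->
  smooth_at M P (fun x' => f (x', y)) x.
Proof.
move=> aM aN [cf [U [oU Up Cf]]]; split.
  by apply: (continuous_comp _ cf); apply: cvg_pair => //; exact: cvg_cst.
exists [set e | U (e, to_model (chart_at y) y)].
split=> [||k]; [exact: open_slice1 | exact: Up |].
have := Ck_slice1 (to_model (chart_at y) y) oU (Cf k); congr (Ck _ _ _).
by apply/funext => e; rewrite /in_charts /= of_model_at.
Qed.

Lemma smooth_at_slice2 (E F D : normedModType R) (M : charted E)
    (N : charted F) (P : charted D) (f : M * N -> P) x y :
  atlas M -> atlas N -> smooth_at (prod_charted M N) P f (x, y) ->
  smooth_at N P (fun y' => f (x, y')) y.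
Proof.
move=> aM aN [cf [U [oU Up Cf]]]; split.
  by apply: (continuous_comp _ cf); apply: cvg_pair => //; exact: cvg_cst.
exists [set e | U (to_model (chart_at x) x, e)].
split=> [||k]; [exact: open_slice2 | exact: Up |].
have := Ck_slice2 (to_model (chart_at x) x) oU (Cf k); congr (Ck _ _ _).
by apply/funext => e; rewrite /in_charts /= of_model_at.
Qed.

Lemma tangent_prod (E F D : normedModType R) (M : charted E)
    (N : charted F) (P : charted D) (f : M * N -> P) x y :
  atlas M -> atlas N ->
  differentiable_at (M := prod_charted M N) (N := P) f (x, y) ->
  forall u v, tangent (prod_charted M N) P f (x, y) (u, v) =
    tangent M P (fun x' => f (x', y)) x u +
    tangent N P (fun y' => f (x, y')) y v.
Proof.
move=> aM aN [_ df] u v.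
have E1 : in_charts (fun x' => f (x', y)) x = fun e =>
    in_charts (M := prod_charted M N) f (x, y) (e, to_model (chart_at y) y).
  by apply/funext => e; rewrite /in_charts /= of_model_at.
have E2 : in_charts (fun y' => f (x, y')) y = fun e =>
    in_charts (M := prod_charted M N) f (x, y) (to_model (chart_at x) x, e).
  by apply/funext => e; rewrite /in_charts /= of_model_at.
rewrite /tangent E1 E2.
rewrite (@diff_val _ _ _ _ _ _ _ (is_diff_slice1 df)).
rewrite (@diff_val _ _ _ _ _ _ _ (is_diff_slice2 df)) -linearD.
by congr ('d _ _ (_, _)); rewrite ?addr0 ?add0r.
Qed.

Lemma tangent_pair (E F D : normedModType R) (M : charted E) (N : charted F)
    (P : charted D) (f : M -> N) (g : M -> P) p :
  differentiable_at f p -> differentiable_at g p ->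
  differentiable_at (N := prod_charted N P) (fun x => (f x, g x)) p /\
  tangent M (prod_charted N P) (fun x => (f x, g x)) p =
    (fun v => (tangent M N f p v, tangent M P g p v)) :> (E -> F * D).
Proof.
move=> [cf df] [cg dg]; split; last exact: diff_pair df dg.
by split; [exact: cvg_pair cf cg | exact: differentiable_pair df dg].
Qed.

Lemma tangent_cst (E F : normedModType R) (M : charted E) (N : charted F)
    (q : N) (p : M) :
  differentiable_at (M := M) (cst q) p /\
  tangent M N (cst q) p = (fun=> 0) :> (E -> F).
Proof.
split; last exact: (diff_cst (to_model (chart_at q) q)).
split; first exact: cvg_cst.
exact: (differentiable_cst (to_model (chart_at q) q)).
Qed.

(** Chain rule with the base point given up to the equation [h 0 = p], since charts and tangent maps
    depend on the point and the curves below reach [g2] and [g3] only through proved equalities. *)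
Lemma tangent_curve (E F : normedModType R) (M : charted E) (N : charted F)
    (h : R -> M) (f : M -> N) p :
  atlas M -> h 0 = p -> differentiable_at (M := line R) h 0 ->
  differentiable_at f p ->
  differentiable_at (M := line R) (f \o h) 0 /\
  forall s, tangent (line R) N (f \o h) 0 s =
    tangent M N f p (tangent (line R) M h 0 s).
Proof.
move=> aM <- dh df; have [d T] := tangent_comp (@atlas_line R) aM dh df.
by split=> // s; rewrite T.
Qed.

End maps.

(** * Curves in the fibres of a submersion *)

Section fibre_curves.
Context {R : realType} {n k : nat}.

Lemma submersion_fibre_curve (M : charted 'rV[R]_n) (N : charted 'rV[R]_k)
    (f : M -> N) p v :
  atlas M -> atlas N -> submersion M N f -> tangent M N f p v = 0 ->
  exists h : R -> M, [/\ smooth_at (line R) M h 0, h 0 = p,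
    \forall t \near (0 : R^o), f (h t) = f p & tangent (line R) M h 0 1 = v].
Proof.
move=> aM aN [/(_ p)[cf [U [oU Up Cf]]] /(_ p) sf] fv0.
have [c [[I [oI I0 Cc]] c0 dc fc]] := curve_in_level_set oU Up Cf sf fv0.
have cc : c x @[x --> (0 : R^o)] --> to_model (chart_at p) p.
  by rewrite -c0; apply: differentiable_continuous; case: dc.
pose h (t : R^o) : M := of_model (chart_at p) (c t).
have h0 : h 0 = p by rewrite /h c0 of_model_at.
have ch : h t @[t --> (0 : R^o)] --> p by exact: of_model_comp_cvg.
(* Near 0 the chart expression of [h] is [c], so smoothness and velocity carry over from [c]. *)
have hE : \forall t \near (0 : R^o),
    c t = in_charts (M := line R) (N := M) h 0 t.
  have nc : \forall t \near (0 : R^o), cod (chart_at p) (c t).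
    exact: cc _ (near_cod aM p).
  apply: filterS nc => t /(of_modelK aM)[E _].
  by rewrite /in_charts /= h0 /h E.
exists h; split=> //.
- split; first by rewrite /prop_for /continuous_at h0.
  have [I' [oI' I'0 I'E]] := nbhs_open_subset hE.
  exists (I `&` I'); split=> [||j]; [exact: openI | by [] |].
  apply: (@Ck_eq _ R^o _ _ _ c); [exact: openI | by move=> x [_ /I'E] |].
  by apply: Ck_subset (Cc j) => x [].
(* Equal coordinates give equal points of [N] only inside the domain of the chart at [f p]. *)
- have nd : \forall t \near (0 : R^o), dom (chart_at (f p)) (f (h t)).
    exact: ch _ (cf _ (near_dom aN (f p))).
  apply: filterS2 fc nd => t.
  rewrite /in_charts /= of_model_at // => E dt.
  have [[_ _ K _ _] dp] := aN (f p).
  by rewrite -(K _ dt) [to_model _ _]E K.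
- have := near_eq_is_diff hE; case: dc => dc dcE /(_ dc)[_ E].
  by rewrite /tangent [LHS](congr1 (fun g => g 1) E) dcE scale1r.
Qed.

End fibre_curves.

(** * Variations and the Euler-Lagrange equations *)

Section groupoid.
Context {R : realType} {n k : nat} {G : manifold R n} {Q : manifold R k}.
Variable gr : lie_groupoid G Q.

Lemma inv_eps q : Defs.inv gr (eps gr q) = eps gr q.
Proof.
have := mul_eps_l gr (Defs.inv gr (eps gr q)).
by rewrite alpha_inv beta_eps mul_inv_r alpha_eps.
Qed.

Let aG := @atlas_manifold _ _ G.

(** Freeze the first argument of a local extension of the multiplication; elements of the fibre are
    composable with [g], so the slice agrees there with the translation. *)
Lemma left_translation_extension g : exists f,
  local_extension G G (alpha_fibre gr (beta gr g)) (left_translation gr g)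
    (eps gr (beta gr g)) f.
Proof.
have Cge : beta gr g = alpha gr (eps gr (beta gr g)) by rewrite alpha_eps.
have [m [sm mE]] := @mul_smooth _ _ _ _ _ gr (g, eps gr (beta gr g)) Cge.
exists (fun h => m (g, h)); split.
  exact: (smooth_at_slice2 (M := G) (N := G) aG aG sm).
have c : {for eps gr (beta gr g), continuous (fun h : G => (g, h))}.
  by apply: cvg_pair => //; exact: cvg_cst.
have nm : \forall h \near eps gr (beta gr g), beta gr g = alpha gr h ->
    m (g, h) = Defs.mul gr g h by exact: c _ mE.
by apply: filterS nm => h /= H ah; rewrite H.
Qed.

(** Inversion acts first, so the multiplication is extended around the inverse of the unit. An [h]
    in the fibre over [q] has [beta] of its inverse equal to [q], hence composable with [g]. *)
Lemma right_translation_inv_extension q g : q = alpha gr g -> exists f,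
  local_extension G G (alpha_fibre gr q) (right_translation gr g \o Defs.inv gr)
    (eps gr q) f.
Proof.
move=> qg.
have Ceg : beta gr (Defs.inv gr (eps gr q)) = alpha gr g.
  by rewrite beta_inv alpha_eps.
have [m [sm mE]] := @mul_smooth _ _ _ _ _ gr (Defs.inv gr (eps gr q), g) Ceg.
have [ci _] := inv_smooth gr (eps gr q).
exists ((fun h => m (h, g)) \o Defs.inv gr); split.
  apply: smooth_at_comp => //; first exact: inv_smooth.
  exact: (smooth_at_slice1 (M := G) (N := G) aG aG sm).
have c : {for Defs.inv gr (eps gr q), continuous (fun h : G => (h, g))}.
  by apply: cvg_pair => //; exact: cvg_cst.
have nm : \forall h \near eps gr q, beta gr (Defs.inv gr h) = alpha gr g ->
    m (Defs.inv gr h, g) = Defs.mul gr (Defs.inv gr h) g.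
  exact: ci _ (c _ mE).
by apply: filterS nm => h /= H ah; rewrite H // beta_inv ah.
Qed.

(** Exposes the very extension selected by [xget], so that the action can be differentiated with it
    and no comparison of extensions arises. *)
Lemma tangent_onP (S : set G) (f : G -> G) p :
  (exists g, local_extension G G S f p g) ->
  exists2 g, local_extension G G S f p g &
    tangent_on G G S f p = tangent G G g p.
Proof.
move=> [g eg]; exists (xget f (local_extension G G S f p)) => //.
exact: (xgetPex _ (ex_intro _ g eg)).
Qed.

Lemma differentiable_at_is_derive (f : R -> R) (t : R) :
  differentiable_at (M := line R) (N := line R) f t ->
  is_derive t 1 f (tangent (line R) (line R) f t 1).
Proof.
by move=> [_ df]; exact: (is_diff_is_derive (1 : R^o) (differentiableP df)).
Qed.

Lemma algebroid_fibre_curve q v : algebroid_fibre gr q v ->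
  exists2 h, fibre_curve gr q h & tangent (line R) G h 0 1 = v.
Proof.
move=> av; have aQ := @atlas_manifold _ _ Q.
have [h [sh h0 hq hv]] :=
  submersion_fibre_curve aG aQ (alpha_submersion gr) av.
exists h => //; split=> //.
by apply: filterS hq => t ->; rewrite alpha_eps.
Qed.

(** [alpha] is constant along [h] near 0, so the chain rule puts the velocity in the kernel of its
    tangent map. *)
Lemma fibre_curve_algebroid q h : fibre_curve gr q h ->
  algebroid_fibre gr q (tangent (line R) G h 0 1).
Proof.
move=> [/smooth_differentiable_at dh hq h0]; rewrite /algebroid_fibre /= -h0.
have da : differentiable_at (alpha gr) (h 0).
  by apply: smooth_differentiable_at; have [+ _] := alpha_submersion gr; apply.
have [_ /(congr1 (fun f => f 1)) /= <-] :=
  tangent_comp (@atlas_line R) aG dh da.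
have near_cst : \forall t \near (0 : line R),
    (cst q : R -> Q) t = (alpha gr \o h) t.
  by apply: filterS hq => t /= ->.
have [dc Tc] := tangent_cst (M := line R) (N := Q) q 0.
have [_ ->] := near_eq_differentiable_at (@atlas_line R) near_cst dc.
by rewrite Tc.
Qed.

Section variations.
Variables (Ld : G * G -> R) (F : G * G -> G * G -> R).
Hypothesis hF : local_extensions gr Ld F.
Variables (g1 g2 g3 g4 : G).
Hypotheses (b12 : beta gr g1 = alpha gr g2) (b23 : beta gr g2 = alpha gr g3).
Hypothesis b34 : beta gr g3 = alpha gr g4.
Let q := beta gr g2.
Variable h : R -> G.
Hypothesis hh : fibre_curve gr q h.

(** The varied pairs remain composable and tend to the original ones, so near 0 each value of [Ld]
    is that of the extension around the original pair. *)
Lemma action_near (a b : R -> G) :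
  a t @[t --> (0 : R^o)] --> g2 -> b t @[t --> (0 : R^o)] --> g3 ->
  (\forall t \near (0 : R^o), a t = Defs.mul gr g2 (h t)) ->
  (\forall t \near (0 : R^o), b t = Defs.mul gr (Defs.inv gr (h t)) g3) ->
  \forall t \near (0 : R^o),
    F (g1, g2) (g1, a t) + F (g2, g3) (a t, b t) + F (g3, g4) (b t, g4) =
    Defs.action Ld (Defs.variation gr (g1, g2, g3, g4) h t).
Proof.
move=> ca cb na nb; have [_ nh _] := hh.
have [_ E12] := hF (x := (g1, g2)) b12.
have [_ E23] := hF (x := (g2, g3)) b23.
have [_ E34] := hF (x := (g3, g4)) b34.
have cst_cvg (x : G) : (cst x : R -> G) t @[t --> (0 : R^o)] --> x.
  exact: cvg_cst.
have n12 := cvg_near_pair (cst_cvg g1) ca E12.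
have n23 := cvg_near_pair ca cb E23.
have n34 := cvg_near_pair cb (cst_cvg g4) E34.
apply: filterS2 (filterI na (filterI nb nh)) (filterI n12 (filterI n23 n34)).
move=> t [at_ [bt aq]] [e12 [e23 e34]].
have abi : beta gr (Defs.inv gr (h t)) = alpha gr g3 by rewrite beta_inv aq.
have aq' : beta gr g2 = alpha gr (h t) by rewrite aq.
rewrite /Defs.action /Defs.variation -at_ -bt e12 ?e23 ?e34 //.
- by rewrite /composable /= bt beta_mul.
- by rewrite /composable /= at_ bt beta_mul // alpha_mul // alpha_inv.
- by rewrite /composable /= at_ alpha_mul.
Qed.

Lemma action_is_derive :
  is_derive (0 : R) 1
    (fun t => Defs.action Ld (Defs.variation gr (g1, g2, g3, g4) h t))
    ((pullback gr q (left_translation gr g2) (D1 F g2 g3 \+ D2 F g1 g2)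
     \+ pullback gr q (right_translation gr g3 \o Defs.inv gr)
       (D1 F g3 g4 \+ D2 F g2 g3)) (tangent (line R) G h 0 1)).
Proof.
(* The equations group the four partial differentials by the element varied, the action by the
   summand; this regroups them. *)
have ac (x y z w : R) : x + y + (z + w) = y + (x + w) + z by ring.
have [sh hq h0] := hh; have dh := smooth_differentiable_at sh.
have [A [sA AE] TA] := tangent_onP (left_translation_extension g2).
have [B [sB BE] TB] := tangent_onP (right_translation_inv_extension b23).
have Ae : A (eps gr q) = g2.
  rewrite (nbhs_singleton AE); first exact: mul_eps_r.
  by rewrite /alpha_fibre /= alpha_eps.
have Be : B (eps gr q) = g3.
  rewrite (nbhs_singleton BE); last by rewrite /alpha_fibre /= alpha_eps.
  by rewrite /right_translation /= inv_eps /q b23 mul_eps_l.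
pose a := A \o h; pose b := B \o h.
have a0 : a 0 = g2 by rewrite /a /= h0.
have b0 : b 0 = g3 by rewrite /b /= h0.
have [da Ta] := tangent_curve aG h0 dh (smooth_differentiable_at sA).
have [db Tb] := tangent_curve aG h0 dh (smooth_differentiable_at sB).
have [s12 _] := hF (x := (g1, g2)) b12.
have [s23 _] := hF (x := (g2, g3)) b23.
have [s34 _] := hF (x := (g3, g4)) b34.
have [d12 T12] := tangent_curve aG a0 da
  (smooth_differentiable_at (smooth_at_slice2 (M := G) (N := G) aG aG s12)).
have [d34 T34] := tangent_curve aG b0 db
  (smooth_differentiable_at (smooth_at_slice1 (M := G) (N := G) aG aG s34)).
have [dab Tab] := tangent_pair da db.
have ab0 : (a 0, b 0) = (g2, g3) by rewrite a0 b0.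
have d23' := smooth_differentiable_at s23.
(* In the middle summand both arguments move: it is differentiated along a curve in [G * G], and
   [tangent_prod] later splits the result into partial differentials. *)
have [d23 T23] := tangent_curve (atlas_prod aG aG) ab0 dab d23'.
have D : is_derive (0 : R) 1 (((fun y => F (g1, g2) (g1, y)) \o a) +
    (F (g2, g3) \o (fun t => (a t, b t))) +
    ((fun x => F (g3, g4) (x, g4)) \o b)) (
    tangent (line R) (line R) ((fun y => F (g1, g2) (g1, y)) \o a) 0 1 +
    tangent (line R) (line R) (F (g2, g3) \o (fun t => (a t, b t))) 0 1 +
    tangent (line R) (line R) ((fun x => F (g3, g4) (x, g4)) \o b) 0 1).
  apply: is_deriveD; first apply: is_deriveD;
    exact: differentiable_at_is_derive.
have -> : (pullback gr q (left_translation gr g2) (D1 F g2 g3 \+ D2 F g1 g2)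
     \+ pullback gr q (right_translation gr g3 \o Defs.inv gr)
       (D1 F g3 g4 \+ D2 F g2 g3)) (tangent (line R) G h 0 1) =
    tangent (line R) (line R) ((fun y => F (g1, g2) (g1, y)) \o a) 0 1 +
    tangent (line R) (line R) (F (g2, g3) \o (fun t => (a t, b t))) 0 1 +
    tangent (line R) (line R) ((fun x => F (g3, g4) (x, g4)) \o b) 0 1.
  rewrite T12 T34 T23 Tab (tangent_prod aG aG d23') Ta Tb.
  rewrite /pullback /= TA TB /D1 /D2.
  exact: ac.
apply: near_eq_is_derive D.
have ch : h t @[t --> (0 : R^o)] --> eps gr q by rewrite -h0; case: dh.
apply: action_near.
- by rewrite -a0; case: da.
- by rewrite -b0; case: db.
- have nA : \forall t \near (0 : R^o), alpha_fibre gr q (h t) ->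
    a t = left_translation gr g2 (h t) by exact: ch _ AE.
  by apply: filterS2 nA hq => t; apply.
- have nB : \forall t \near (0 : R^o), alpha_fibre gr q (h t) ->
    b t = (right_translation gr g3 \o Defs.inv gr) (h t) by exact: ch _ BE.
  by apply: filterS2 nB hq => t; apply.
Qed.

End variations.

End groupoid.

Theorem proposition1 (R : realType) (n k : nat)
    (G : manifold R n) (Q : manifold R k) (gr : lie_groupoid G Q)
    (Ld : G * G -> R) (hLd : lagrangian gr Ld)
    (F : G * G -> G * G -> R) (hF : local_extensions gr Ld F)
    (g : G) (s : G * G * G * G) (hs : C4 gr g s) :
  solution gr Ld s <-> second_order_EL gr F s.
Proof.
case: s hs => [[[g1 g2] g3] g4] [b12 b23 b34 _]; split.
- move=> sol v /algebroid_fibre_curve[h hh <-].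
  (* The left-hand side is the derivative of the action along [h], which is 0 by hypothesis. *)
  have [_ <-] := action_is_derive hF b12 b23 b34 hh.
  by have [] := sol h hh.
- move=> EL h hh; have := action_is_derive hF b12 b23 b34 hh.
  by rewrite (EL _ (fibre_curve_algebroid hh)).
Qed.
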